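(* Let $R$ be a $\mathbb{Q}$-domain, $n=2$, and $D\in\mathrm{LND}_R R[x_1,x_2]$. If $\exp fD\in\mathrm{T}(R,\mathbf{x})$ for some $f\in\ker D\setminus\{0\}$, then $\exp D\in\mathrm{T}(R,\mathbf{x})$.
   Context: $\mathrm{LND}_R R[\mathbf{x}]$ is the set of locally nilpotent $R$-derivations; $\exp D(f)=\sum_{l\ge0}D^l(f)/l!$. $\mathrm{T}(R,\mathbf{x})$ is the subgroup of $\mathrm{Aut}(R[\mathbf{x}]/R)$ generated by affine automorphisms ($\deg\phi(x_i)=1$ for all $i$) and elementary automorphisms (fixing all variables but one). *)

(* Defs.v *)
From HB Require Import structures.
From mathcomp Require Import all_boot all_order all_algebra.
From mathcomp Require Import mpoly.
From Stdlib Require Import ClassicalEpsilon.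
Set Implicit Arguments. Unset Strict Implicit. Unset Printing Implicit Defensive.
Import GRing.Theory.
Local Open Scope ring_scope.

Section Defs.
Variables (n : nat) (R : idomainType).
Local Notation P := {mpoly R[n]}.

(* R is a Q-domain: an integral domain containing Q, i.e. every positive
   integer is invertible in R. *)
Definition Qdomain : Prop := forall k : nat, (k.+1)%:R \is a @GRing.unit R.

Definition is_Rderivation (D : P -> P) : Prop :=
  [/\ forall p q, D (p + q) = D p + D q,
      forall (c : R) p, D (c *: p) = c *: D p &
      forall p q, D (p * q) = D p * q + p * D q].

Definition is_LND (D : P -> P) : Prop :=
  is_Rderivation D /\ forall p, exists l, iter l D p = 0.

Definition nilidx (D : P -> P) (p : P) : nat :=
  match excluded_middle_informative (exists l, iter l D p == 0) with
  | left H => ex_minn H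
  | right _ => 0%N
  end.

(* exp D (p) = sum_{l >= 0} D^l(p) / l!  (a finite sum for D locally nilpotent) *)
Definition lnd_exp (D : P -> P) (p : P) : P :=
  \sum_(l < nilidx D p) ((l`!)%:R : R)^-1 *: iter l D p.

Definition is_RAut (phi : P -> P) : Prop :=
  [/\ forall p q, phi (p + q) = phi p + phi q,
      forall p q, phi (p * q) = phi p * phi q,
      phi 1 = 1,
      forall (c : R) p, phi (c *: p) = c *: phi p &
      bijective phi].

(* affine automorphism: deg phi(x_i) = 1 for all i  (msize = 1 + total degree) *)
Definition is_affine_aut (phi : P -> P) : Prop :=
  is_RAut phi /\ forall i : 'I_n, msize (phi 'X_i) = 2%N.

Definition is_elementary_aut (phi : P -> P) : Prop :=
  is_RAut phi /\ exists i : 'I_n, forall j : 'I_n, j != i -> phi 'X_j = 'X_j.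

(* T(R,x): subgroup of Aut(R[x]/R) generated by affine and elementary
   automorphisms (automorphisms identified up to pointwise equality). *)
Inductive tame : (P -> P) -> Prop :=
| tame_affine phi : is_affine_aut phi -> tame phi
| tame_elementary phi : is_elementary_aut phi -> tame phi
| tame_comp a b : tame a -> tame b -> tame (a \o b)
| tame_inv a b : tame a -> cancel a b -> cancel b a -> tame b
| tame_ext a b : tame a -> a =1 b -> tame b.

End Defs.

(* Main.v *)
(* Conjugating inside the tame group and merging neighbouring letters, a tame automorphism
   becomes affine, triangular, or a cyclically alternating word in non-affine triangular and
   non-triangular affine maps.  Powers of such a word have unbounded degree, whereas the
   degrees of the iterates of exp E on a fixed polynomial are bounded, for E locally
   nilpotent; so exp (f D) is conjugate to exp (f' D') with exp (f' D') affine or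
   triangular.  Subspaces stable under exp (f' D') are stable under f' D', which bounds the
   degrees of f' D'(x_i); dividing by f', the derivation D' itself has affine
   (resp. triangular) shape, and so does exp D'. *)
Require Import Defs.
From HB Require Import structures.
From mathcomp Require Import all_boot all_order all_algebra.
From mathcomp Require Import mpoly.
From mathcomp Require Import ring zify.
From Stdlib Require Import ClassicalEpsilon FunctionalExtensionality.
Set Implicit Arguments. Unset Strict Implicit. Unset Printing Implicit Defensive.
Import GRing.Theory.
Local Open Scope ring_scope.

(** * Exponentials of locally nilpotent derivations *)

Section Exponential.
Variables (n : nat) (R : idomainType).
Hypothesis hQ : Qdomain R.
Local Notation P := {mpoly R[n]}.

Lemma fact_unit (l : nat) : (l`!)%:R \is a @GRing.unit R.
Proof. by move: (hQ (l`!).-1); rewrite prednK ?fact_gt0. Qed.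

Lemma derC (D : P -> P) (c : R) : is_Rderivation D -> D c%:MP = 0.
Proof.
case=> _ DZ DM.
have D1 : D 1 = 0.
  by apply/(addrI (D 1)); rewrite addr0 -[RHS](congr1 D (mulr1 1)) DM mulr1 mul1r.
by rewrite -[c%:MP]mulr1 mul_mpolyC DZ D1 scaler0.
Qed.

Section Derivation.
Variable D : P -> P.
Hypothesis hD : is_LND D.

Lemma derD p q : D (p + q) = D p + D q. Proof. by case: hD => -[]. Qed.
Lemma derZ c p : D (c *: p) = c *: D p. Proof. by case: hD => -[]. Qed.
Lemma derM p q : D (p * q) = D p * q + p * D q. Proof. by case: hD => -[]. Qed.

Lemma der0 : D 0 = 0.
Proof. by have := derZ 0 0; rewrite !scale0r. Qed.

Lemma iterD0 l : iter l D 0 = 0.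
Proof. by elim: l => //= l ->; rewrite der0. Qed.

Lemma iterDD l p q : iter l D (p + q) = iter l D p + iter l D q.
Proof. by elim: l => //= l ->; rewrite derD. Qed.

Lemma iterDZ l c p : iter l D (c *: p) = c *: iter l D p.
Proof. by elim: l => //= l ->; rewrite derZ. Qed.

Lemma iterD_sum l (N : nat) (F : 'I_N -> P) :
  iter l D (\sum_(i < N) F i) = \sum_(i < N) iter l D (F i).
Proof.
apply: (big_morph (iter l D)) => [p q|]; [exact: iterDD|exact: iterD0].
Qed.

Lemma iterD_nilidx p : iter (nilidx D p) D p = 0.
Proof.
rewrite /nilidx; case: excluded_middle_informative => [ex|[]].
  by case: ex_minnP => m /eqP.
by case: hD => _ /(_ p) [l hl]; exists l; apply/eqP.
Qed.

Lemma iterD_ge p N l : iter N D p = 0 -> (N <= l)%N -> iter l D p = 0.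
Proof. by move=> hN /subnK <-; rewrite iterD hN iterD0. Qed.

(** The divided power of [D], for which the Leibniz rule carries no binomial coefficients. *)
Definition dpow l p : P := ((l`!)%:R : R)^-1 *: iter l D p.

Lemma dpow0 p : dpow 0 p = p.
Proof. by rewrite /dpow /= invr1 scale1r. Qed.

Lemma der_dpow l p : D (dpow l p) = (l.+1)%:R *: dpow l.+1 p.
Proof.
rewrite /dpow derZ scalerA -iterS factS natrM invrM ?hQ ?fact_unit //.
by rewrite mulrCA divrr ?hQ // mulr1.
Qed.

(** Applying [D] to the rule for [l] yields the rule for [l.+1] multiplied by [l.+1], and this
    factor cancels because it is a unit. *)
Lemma dpowM l p q :
  dpow l (p * q) = \sum_(i < l.+1) dpow i p * dpow (l - i) q.
Proof.
elim: l => [|l IH].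
  by rewrite big_ord_recl big_ord0 addr0 subn0 !dpow0.
have inj : injective (fun z : P => (l.+1)%:R *: z).
  by move=> z t /(congr1 (fun z => (l.+1)%:R^-1 *: z)); rewrite !scalerA mulVr ?hQ ?scale1r.
apply: inj; rewrite -der_dpow IH -[LHS]/(iter 1 D _) iterD_sum.
under eq_bigr => i _ do rewrite /= derM !der_dpow.
rewrite big_split /= scaler_sumr.
(* The two halves of the Leibniz rule are reindexed over the same range with weights [i] and
   [l.+1 - i], which add up to [l.+1]; the extra boundary term of each has weight zero. *)
have -> : \sum_(i < l.+1) ((i.+1)%:R : R) *: dpow i.+1 p * dpow (l - i) q =
          \sum_(i < l.+2) ((i%:R : R) *: (dpow i p * dpow (l.+1 - i) q)).
  rewrite [RHS]big_ord_recl scale0r add0r.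
  by apply: eq_bigr => i _; rewrite scalerAl subSS.
have -> : \sum_(i < l.+1) dpow i p * (((l - i).+1)%:R *: dpow (l - i).+1 q) =
          \sum_(i < l.+2) (((l.+1 - i)%:R : R) *: (dpow i p * dpow (l.+1 - i) q)).
  rewrite [RHS]big_ord_recr /= subnn scale0r addr0.
  by apply: eq_bigr => i _; rewrite subSn ?scalerAr // -ltnS.
rewrite -big_split; apply: eq_bigr => i _ /=.
by rewrite -scalerDl -natrD subnKC // -ltnS.
Qed.

(** This is [exp (t D) p] as a polynomial in [t]: its value at 1 is [exp D p], and its degree in [t]
    measures the nilpotency of [D] on [p]. *)
Definition exp_poly p : {poly P} := \poly_(l < nilidx D p) dpow l p.

Lemma coef_exp_poly p l : (exp_poly p)`_l = dpow l p.
Proof.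
rewrite coef_poly; case: ltnP => // h.
by rewrite /dpow (iterD_ge (iterD_nilidx p) h) scaler0.
Qed.

Lemma exp_polyM p q : exp_poly (p * q) = exp_poly p * exp_poly q.
Proof.
apply/polyP => l; rewrite coefM coef_exp_poly dpowM.
by apply: eq_bigr => i _; rewrite !coef_exp_poly.
Qed.

Lemma exp_polyD p q : exp_poly (p + q) = exp_poly p + exp_poly q.
Proof. by apply/polyP => l; rewrite coefD !coef_exp_poly /dpow iterDD scalerDr. Qed.

Lemma lnd_expE p : lnd_exp D p = (exp_poly p).[1].
Proof.
by rewrite horner_poly; apply: eq_bigr => i _; rewrite expr1n mulr1.
Qed.

Lemma lnd_exp_sum p N : iter N D p = 0 -> lnd_exp D p = \sum_(l < N) dpow l p.
Proof.
move=> hN; rewrite lnd_expE (_ : exp_poly p = \poly_(l < N) dpow l p).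
  by rewrite horner_poly; apply: eq_bigr => i _; rewrite expr1n mulr1.
apply/polyP => l; rewrite coef_exp_poly coef_poly; case: ltnP => // h.
by rewrite /dpow (iterD_ge hN h) scaler0.
Qed.

Lemma lnd_expD p q : lnd_exp D (p + q) = lnd_exp D p + lnd_exp D q.
Proof. by rewrite !lnd_expE exp_polyD hornerD. Qed.

Lemma lnd_expM p q : lnd_exp D (p * q) = lnd_exp D p * lnd_exp D q.
Proof. by rewrite !lnd_expE exp_polyM hornerM. Qed.

Lemma lnd_exp_ker p : D p = 0 -> lnd_exp D p = p.
Proof. by move=> h; rewrite (@lnd_exp_sum _ 1) // big_ord1 dpow0. Qed.

Lemma lnd_expZ c p : lnd_exp D (c *: p) = c *: lnd_exp D p.
Proof.
by rewrite -!mul_mpolyC lnd_expM lnd_exp_ker // derC; case: hD.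
Qed.

Lemma iter_lnd_exp l p N : iter N D p = 0 ->
  iter l D (lnd_exp D p) = \sum_(i < N) ((i`!)%:R : R)^-1 *: iter (l + i) D p.
Proof.
move=> hN; rewrite (lnd_exp_sum hN) iterD_sum.
by apply: eq_bigr => i _; rewrite iterDZ -iterD.
Qed.

(** If [exp D p = 0] and [D^(N+1) p = 0], then applying [D^N] to the exponential leaves only
    [D^N p], which therefore vanishes; descending on [N] gives [p = 0]. *)
Lemma lnd_exp_inj : injective (lnd_exp D).
Proof.
suff H p : lnd_exp D p = 0 -> p = 0.
  move=> p q h; apply/subr0_eq/H.
  by rewrite -scaleN1r lnd_expD lnd_expZ scaleN1r h subrr.
move=> h; have: iter (nilidx D p) D p = 0 by apply: iterD_nilidx.
elim: (nilidx D p) => // N IH hN; apply: IH.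
have := iter_lnd_exp N hN; rewrite h iterD0 big_ord_recl addn0 invr1 scale1r.
rewrite big1 ?addr0 // => i _.
by rewrite (iterD_ge hN) ?scaler0 // lift0 addnS ltnS leq_addr.
Qed.

(** The difference [q - exp D q] is killed by a smaller power of [D] than [q] is, so induction on
    that power supplies a preimage of it, to which [q] is added. *)
Lemma lnd_exp_surj q : exists p, lnd_exp D p = q.
Proof.
have: iter (nilidx D q) D q = 0 by apply: iterD_nilidx.
move: (nilidx D q) => N; elim: N q => [|N IH] q hN; first by exists 0; rewrite lnd_exp_ker ?der0.
have [|p hp] := IH (q - lnd_exp D q); last first.
  by exists (p + q); rewrite lnd_expD hp subrK.
rewrite -scaleN1r iterDD iterDZ (iter_lnd_exp _ hN) big_ord_recl addn0 invr1 scale1r.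
rewrite big1 ?addr0 ?scaleN1r ?subrr // => i _.
by rewrite (iterD_ge hN) ?scaler0 // lift0 addnS ltnS leq_addr.
Qed.

Lemma inj_surj_bij (T : choiceType) (f : T -> T) :
  injective f -> (forall y, exists x, f x = y) -> bijective f.
Proof.
move=> fI fS; have ex y : exists x, f x == y by have [x <-] := fS y; exists x.
exists (fun y => xchoose (ex y)) => [x|y]; last exact/eqP/(xchooseP (ex y)).
by apply: fI; apply/eqP/(xchooseP (ex (f x))).
Qed.

Lemma lnd_exp_RAut : is_RAut (lnd_exp D).
Proof.
split; [exact: lnd_expD | exact: lnd_expM | | exact: lnd_expZ |].
  by rewrite lnd_exp_ker // -mpolyC1 derC //; case: hD.
exact: inj_surj_bij lnd_exp_inj lnd_exp_surj.
Qed.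

(** Since [exp (t D)] is multiplicative and the polynomial ring is a domain, degrees in [t] add up;
    the product has degree 0, hence so does each factor. *)
Lemma ker_factorially_closed p q : p * q != 0 -> D (p * q) = 0 -> D q = 0.
Proof.
rewrite mulf_eq0 negb_or => /andP[p0 q0] h.
have exp_poly0 r : r != 0 -> exp_poly r != 0.
  by apply: contra_neq => /(congr1 (fun s : {poly P} => s`_0)); rewrite coef_exp_poly dpow0 coef0.
have: (size (exp_poly p * exp_poly q)%R <= 1)%N.
  rewrite -exp_polyM; apply/leq_sizeP => -[//|l] _.
  by rewrite coef_exp_poly /dpow iterSr h iterD0 scaler0.
rewrite size_mul ?exp_poly0 // => hs.
have hq : (size (exp_poly q) <= 1)%N.
  move: hs; have: (0 < size (exp_poly p))%N by rewrite size_poly_gt0 exp_poly0.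
  by case: (size _) => // a _; rewrite addSn; apply: leq_trans; apply: leq_addl.
by move/leq_sizeP: hq => /(_ 1%N isT); rewrite coef_exp_poly /dpow /= invr1 scale1r.
Qed.

(* If [E^k p = 0], then [q := exp E p - p] satisfies [E^(k-1) q = 0]; by induction all [E^l q]
   lie in the subspace, and the [E^l p] are recovered from them by descending induction on [l]. *)
Lemma lnd_exp_stable (U : P -> Prop) :
    (forall p q, U p -> U q -> U (p + q)) -> (forall c p, U p -> U (c *: p)) ->
    (forall p, U p -> U (lnd_exp D p)) ->
  forall p, U p -> forall l, U (iter l D p).
Proof.
move=> UD UZ Ue p Up.
have: iter (nilidx D p) D p = 0 by apply: iterD_nilidx.
move: (nilidx D p) => N; elim: N p Up => [|N IH] p Up hN l.
  by rewrite (iterD_ge hN) // -(scale0r p); apply: UZ.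
have U0 : U 0 by rewrite -(scale0r p); apply: UZ.
set q := lnd_exp D p + (-1) *: p.
have iterq j : iter j D q = \sum_(i < N) ((i.+1`!)%:R : R)^-1 *: iter (j + i.+1) D p.
  rewrite iterDD iterDZ (iter_lnd_exp _ hN) big_ord_recl addn0 invr1 scale1r.
  by rewrite scaleN1r addrAC subrr add0r.
have Uq : U q by apply: UD; [apply: Ue|apply: UZ].
have hq j : U (iter j D q).
  apply: IH => //; rewrite iterq big1 // => i _.
  by rewrite (iterD_ge hN) ?scaler0 // addnS ltnS leq_addr.
elim: {l}(N.+1 - l)%N {-2}l (leqnn (N.+1 - l)) => [|k IHk] l hl.
  by rewrite (iterD_ge hN) // -subn_eq0 -leqn0.
case: l hl => [//|l] hl.
have [lN|Nl] := ltnP l N; last by rewrite (iterD_ge hN).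
have := hq l; rewrite iterq; case: N hN hl lN {iterq IH hq} IHk => // N _ hl _ IHk.
rewrite big_ord_recl invr1 scale1r addn1; set S := \sum_(i < N) _ => hS.
have US : U S.
  rewrite /S; elim/big_ind: _ => // i _; apply: UZ; apply: IHk; rewrite lift0.
  by move: hl; rewrite !addnS !subSS; lia.
by rewrite -[iter l.+1 D p](addrK S) -scaleN1r; apply: UD => //; apply: UZ.
Qed.

(** [D^l (exp D p)] is a combination of the [D^(l+i) p], so the largest degree among the finitely
    many nonzero [D^l p] is never exceeded. The induction on [m] bounds all [l] at once. *)
Lemma iter_lnd_exp_bounded p : exists B, forall m, (msize (iter m (lnd_exp D) p) <= B)%N.
Proof.
pose B := \max_(l < nilidx D p) msize (iter l D p).
exists B.
suff H m l : (msize (iter l D (iter m (lnd_exp D) p)) <= B)%N by move=> m; apply: (H m 0%N).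
elim: m l => [|m IH] l /=.
  case: (ltnP l (nilidx D p)) => h.
    exact: (@leq_bigmax _ (fun i : 'I__ => msize (iter i D p)) (Ordinal h)).
  by rewrite (iterD_ge (iterD_nilidx p) h) msize0.
rewrite (iter_lnd_exp _ (iterD_nilidx _)).
apply: leq_trans (msize_sum _ _ _) _; apply/bigmax_leqP => i _.
exact: leq_trans (msizeZ_le _ _) (IH _).
Qed.

End Derivation.
End Exponential.

(** * Polynomials in two variables *)

Lemma ord2P (i : 'I_2) : i = ord0 \/ i = ord_max.
Proof. by case: i => -[|[|//]] h; [left|right]; apply: val_inj. Qed.

Section Plane.
Variable R : idomainType.
Hypothesis hQ : Qdomain R.
Local Notation P := {mpoly R[2]}.
Local Notation X := ('X_ord0 : P).
Local Notation Y := ('X_ord_max : P).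
Local Notation "p ^Y" := (mderiv ord_max p) (at level 2, format "p ^Y").

Lemma mpoly_alg_ind (K : P -> Prop) :
    (forall c, K c%:MP) -> (forall p q, K p -> K q -> K (p + q)) ->
    (forall p q, K p -> K q -> K (p * q)) -> K X -> K Y ->
  forall p, K p.
Proof.
move=> KC KD KM KX KY; elim/mpolyind => [|c m p _ _ Kp]; first by rewrite -(mpolyC0 2).
apply: KD => //; rewrite -mul_mpolyC; apply: (KM) => //.
rewrite mpolyXE_id; elim/big_ind: _ => [||i _]; [by rewrite -mpolyC1|exact: KM|].
have Ki : K 'X_i by case: (ord2P i) => ->.
by elim: (m i) => [|k IH]; [rewrite expr0 -mpolyC1|rewrite exprS; apply: KM].
Qed.

Lemma mderivU (i j : 'I_2) : ('X_i : P)^`M(j) = (i == j)%:R.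
Proof.
rewrite mderivX mnm1E; case: eqP => [->|_]; last by rewrite scale0r.
by rewrite (_ : (_ - _)%MM = 0%MM) ?mpolyX0 ?scale1r //; apply/mnmP => k; rewrite mnmBE subnn mnm0E.
Qed.

Lemma msizeXi (i : 'I_2) : msize ('X_i : P) = 2%N.
Proof. by rewrite msizeX mdeg1. Qed.

Lemma msizeD_bound k (p q : P) : (msize p <= k)%N -> (msize q <= k)%N -> (msize (p + q) <= k)%N.
Proof. by move=> hp hq; apply: leq_trans (msizeD_le _ _) _; rewrite geq_max hp. Qed.

Lemma msizeC_le1 c : (msize (c%:MP : P) <= 1)%N.
Proof. by rewrite msizeC; case: (_ != _). Qed.

Lemma msizeDl (p q : P) : (msize q < msize p)%N -> msize (p + q) = msize p.
Proof.
move=> h; apply/eqP; rewrite eqn_leq msizeD_bound // ?(ltnW h) //=.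
rewrite leqNgt; apply/negP => h2; have := ltnn (msize p).
rewrite -{1}(addrK q p) => /negP; apply.
apply: leq_ltn_trans (msizeD_le _ _) _.
by rewrite gtn_max h2 msizeN.
Qed.

Lemma msizeM_factor (p q : P) : p != 0 -> (msize q <= msize (p * q))%N.
Proof.
move=> p0; have [->|q0] := eqVneq q 0; first by rewrite mulr0.
rewrite msizeM //; move: p0; rewrite -msize_poly_eq0.
by case: (msize p) => // a _; rewrite addSn leq_addl.
Qed.

Lemma msize_mderiv (i : 'I_2) (p : P) : (msize p^`M(i) <= (msize p).-1)%N.
Proof.
rewrite [X in (X <= _)%N]msizeE; apply/bigmax_leqP_seq => m hm _.
have: (m + U_(i))%MM \in msupp p.
  rewrite mcoeff_msupp; move: hm; rewrite mcoeff_msupp mcoeff_mderiv.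
  by apply: contra_neq => ->; rewrite mul0rn.
by move/msize_mdeg_lt; rewrite mdegD mdeg1 addn1; case: (msize p).
Qed.

Lemma mderiv_LND (i : 'I_2) : is_LND (fun p : P => p^`M(i)).
Proof.
split; first split; [exact: mderivD|move=> c p; exact: mderivZ|exact: mderivM|].
suff H k (p : P) : (msize p <= k)%N -> iter k (fun p : P => p^`M(i)) p = 0.
  by move=> p; exists (msize p); apply: H.
elim: k p => [|k IH] p h; first by apply/eqP; rewrite -msize_poly_eq0 -leqn0.
rewrite iterSr; apply: IH; apply: leq_trans (msize_mderiv _ _) _.
by rewrite -subn1 leq_subLR add1n.
Qed.

Definition at_poly (F : P) (h : {poly R}) : P := horner_alg F h.

Lemma at_polyMXaddC F h c : at_poly F (h * 'X + c%:P) = at_poly F h * F + c%:MP.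
Proof.
by rewrite /at_poly rmorphD rmorphM /= horner_algX horner_algC alg_mpolyC.
Qed.

Lemma at_poly0 F : at_poly F 0 = 0. Proof. exact: rmorph0. Qed.

Lemma at_poly_deriv F h : F^Y = 0 -> (at_poly F h)^Y = 0.
Proof.
move=> FY; elim/poly_ind: h => [|h c IH]; first by rewrite at_poly0 mderiv0.
by rewrite at_polyMXaddC mderivD mderivC mderivM IH FY mul0r mulr0 !addr0.
Qed.

(** Degrees multiply under composition over a domain; [msize] and [size] are degrees plus one,
    whence the predecessors. *)
Lemma msize_at_poly F h : (1 < msize F)%N -> h != 0 ->
  msize (at_poly F h) = ((size h).-1 * (msize F).-1).+1.
Proof.
move=> F1; have F0 : F != 0 by rewrite -msize_poly_eq0; case: (msize F) F1.
elim/poly_ind: h => [|h c IH]; first by rewrite eqxx.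
rewrite at_polyMXaddC size_MXaddC; have [->|h0] := eqVneq h 0.
  rewrite mul0r add0r /= polyC_eq0 => c0.
  by rewrite (negbTE c0) at_poly0 mul0r add0r msizeC c0 size_poly0 mul0n.
move=> _ /=.
have a0 : at_poly F h != 0 by rewrite -msize_poly_eq0 IH.
have hs : msize (at_poly F h * F) = (size h * (msize F).-1).+1.
  rewrite msizeM // IH //; move: h0; rewrite -size_poly_eq0.
  case: (size h) => // s _; case: (msize F) F1 => // t _ /=.
  by rewrite mulSn; lia.
rewrite msizeDl // hs msizeC; move: h0; rewrite -size_poly_eq0.
case: (size h) => // s _; case: (msize F) F1 => // -[|t] // _.
by rewrite ltnS (leq_trans (leq_b1 _)).
Qed.

(** A monomial containing [y] would survive differentiation, its exponent being nonzero in [R] by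
    [hQ]; so only powers of [x] occur. *)
Lemma ker_mderivY (q : P) : q^Y = 0 -> exists h, q = at_poly X h.
Proof.
move=> qY; exists (\sum_(m <- msupp q) q@_m *: 'X^(m ord0)).
rewrite /at_poly rmorph_sum [LHS]mpolyE big_seq [RHS]big_seq.
apply: eq_bigr => m hm; rewrite -mul_polyC rmorphM rmorphXn /= horner_algX horner_algC.
rewrite -[LHS]mul_mpolyC alg_mpolyC.
congr (_ * _); rewrite mpolyXE_id 2!big_ord_recl big_ord0 mulr1.
rewrite (_ : lift ord0 ord0 = ord_max); last exact: val_inj.
suff -> : m ord_max = 0%N by rewrite expr0 mulr1.
apply/eqP; apply: contraTT hm => m1; rewrite mcoeff_msupp negbK.
have := congr1 (fun p : P => p@_(m - U_(ord_max))) qY.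
rewrite mcoeff_mderiv submK ?lep1mP // mcoeff0 -mulr_natr => /eqP.
rewrite mulf_eq0 => /orP[//|/eqP z]; have := hQ ((m - U_(ord_max))%MM ord_max).
by rewrite z unitr0.
Qed.

Lemma msize_le1 (q : P) : (msize q <= 1)%N -> exists c, q = c%:MP.
Proof. by move/msize1_polyC => ->; eexists. Qed.

Lemma mderivYC_form (q : P) : (msize q^Y <= 1)%N -> exists b h, q = b *: Y + at_poly X h.
Proof.
move=> /msize_le1[b hb]; have [|h hh] := @ker_mderivY (q - b *: Y).
  by rewrite mderivB mderivZ mderivU eqxx hb -mul_mpolyC mulr1 subrr.
by exists b, h; rewrite -hh addrC subrK.
Qed.

Lemma msize2_form (q : P) : (msize q <= 2)%N -> exists a b c, q = a *: X + b *: Y + c%:MP.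
Proof.
move=> q2; exists q@_U_(ord0), q@_U_(ord_max), q@_0.
apply/mpolyP => m; rewrite !mcoeffD !mcoeffZ !mcoeffX mcoeffC.
have [m0|] := eqVneq m 0%MM.
  by rewrite m0 !mnm1_eq0 !mulr0 !add0r mulr1.
rewrite -mdeg_eq0 => m0.
case: (ltngtP (mdeg m) 1) => [|m1|/eqP]; first by case: (mdeg m) m0.
  rewrite memN_msupp_eq0; last by apply: msize_mdeg_ge; apply: leq_trans m1.
  do 2!(case: eqP m1 => [<-|_ m1]; first by rewrite mdeg1).
  by rewrite !mulr0 !addr0.
rewrite mdeg_eq1 => /existsP[i /eqP ->].
by case: (ord2P i) => ->; rewrite !eqxx ?mnm1_eq0 !eq_mnm1 ?mulr0 ?mulr1 ?addr0 ?add0r.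
Qed.

End Plane.

(** * Affine and triangular automorphisms *)

Section Automorphisms.
Variable R : idomainType.
Hypothesis hQ : Qdomain R.
Local Notation P := {mpoly R[2]}.
Local Notation X := ('X_ord0 : P).
Local Notation Y := ('X_ord_max : P).
Local Notation "p ^X" := (mderiv ord0 p) (at level 2, format "p ^X").
Local Notation "p ^Y" := (mderiv ord_max p) (at level 2, format "p ^Y").
Implicit Types phi psi a b t e : P -> P.

Lemma RAut_id : is_RAut (@id P).
Proof. by split=> //; exists id. Qed.

Lemma RAut_comp phi psi : is_RAut phi -> is_RAut psi -> is_RAut (phi \o psi).
Proof.
case=> aD aM a1 aZ aB [bD bM b1 bZ bB]; split => //=.
- by move=> p q; rewrite bD aD.
- by move=> p q; rewrite bM aM.
- by rewrite b1 a1.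
- by move=> c p; rewrite bZ aZ.
- exact: bij_comp.
Qed.

Lemma RAut_inv a b : is_RAut a -> cancel a b -> cancel b a -> is_RAut b.
Proof.
move=> [aD aM a1 aZ _] ab ba; split.
- by move=> p q; rewrite -[in LHS](ba p) -[in LHS](ba q) -aD ab.
- by move=> p q; rewrite -[in LHS](ba p) -[in LHS](ba q) -aM ab.
- by rewrite -[in LHS]a1 ab.
- by move=> c p; rewrite -[in LHS](ba p) -aZ ab.
- by exists a.
Qed.

Lemma RAut_ext a b : is_RAut a -> a =1 b -> is_RAut b.
Proof.
move=> [aD aM a1 aZ aB] ab; split => *; rewrite -?ab //.
exact: eq_bij ab.
Qed.

Lemma RAut_has_inv phi : is_RAut phi -> exists psi, cancel phi psi /\ cancel psi phi.
Proof. by case=> _ _ _ _ [psi h1 h2]; exists psi. Qed.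

Lemma RAutC phi c : is_RAut phi -> phi c%:MP = c%:MP.
Proof. by case=> _ _ h1 hZ _; rewrite -[c%:MP]mulr1 mul_mpolyC hZ h1. Qed.

Lemma RAut0 phi : is_RAut phi -> phi 0 = 0.
Proof. by move=> h; rewrite -(mpolyC0 2) RAutC. Qed.

Lemma RAut_inj phi : is_RAut phi -> injective phi.
Proof. by case=> _ _ _ _ /bij_inj. Qed.

Lemma RAut_neq0 phi p : is_RAut phi -> p != 0 -> phi p != 0.
Proof. by move=> h; apply: contra_neq => h0; apply: (RAut_inj h); rewrite h0 RAut0. Qed.

Lemma RAut_at_poly phi F h : is_RAut phi -> phi (at_poly F h) = at_poly (phi F) h.
Proof.
move=> hphi; case: (hphi) => hD hM _ _ _.
elim/poly_ind: h => [|h c IH]; first by rewrite !at_poly0 RAut0.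
by rewrite !at_polyMXaddC hD hM IH RAutC.
Qed.

Lemma RAut_eq phi psi : is_RAut phi -> is_RAut psi ->
  phi X = psi X -> phi Y = psi Y -> phi =1 psi.
Proof.
move=> h1 h2 hX hY; case: (h1) (h2) => aD aM _ _ _ [bD bM _ _ _].
apply: mpoly_alg_ind => //; first by move=> c; rewrite !RAutC.
- by move=> p q hp hq; rewrite aD bD hp hq.
- by move=> p q hp hq; rewrite aM bM hp hq.
Qed.

(** A constant is already its own image, so by injectivity it is not the image of a variable. *)
Lemma RAut_msizeX phi i : is_RAut phi -> (1 < msize (phi 'X_i))%N.
Proof.
move=> h; rewrite ltnNge; apply/negP => /msize_le1[c].
rewrite -(RAutC c h) => /(RAut_inj h) /(congr1 (fun p : P => msize p)).
by rewrite msizeXi msizeC; case: (c != 0).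
Qed.

Lemma derivation_chain (D : P -> P) : is_Rderivation D ->
  forall p, D p = p^X * D X + p^Y * D Y.
Proof.
move=> hD; case: (hD) => DD DZ DM; apply: mpoly_alg_ind => [c|p q hp hq|p q hp hq||].
- by rewrite derC // !mderivC !mul0r addr0.
- by rewrite DD hp hq !mderivD; ring.
- by rewrite DM hp hq !mderivM; ring.
- by rewrite !mderivU eqxx /= mul1r mul0r addr0.
- by rewrite !mderivU eqxx /= mul1r mul0r add0r.
Qed.

Lemma mderiv_chain phi i : is_RAut phi ->
  forall p, (phi p)^`M(i) = phi p^X * (phi X)^`M(i) + phi p^Y * (phi Y)^`M(i).
Proof.
move=> h; case: (h) => hD hM h1 _ _; apply: mpoly_alg_ind => [c|p q hp hq|p q hp hq||].
- by rewrite RAutC // !mderivC RAut0 // !mul0r addr0.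
- by rewrite hD !mderivD hp hq !hD; ring.
- by rewrite hM !mderivM hp hq !hD !hM; ring.
- by rewrite !mderivU eqxx /= h1 RAut0 // mul1r mul0r addr0.
- by rewrite !mderivU eqxx /= h1 RAut0 // mul1r mul0r add0r.
Qed.

(** An upper bound replaces the equality of [is_affine_aut], since bounds pass to linear
    combinations; for automorphisms both conditions agree. *)
Definition affine phi := is_RAut phi /\ forall i, (msize (phi 'X_i) <= 2)%N.

(* [x |-> u x + c, y |-> v y + h(x)] *)
Definition triangular phi :=
  [/\ is_RAut phi, (phi X)^Y = 0, (msize (phi X) <= 2)%N & (msize (phi Y)^Y <= 1)%N].

Lemma affine_affine_aut phi : affine phi <-> is_affine_aut phi.
Proof.
split=> -[h hs]; split=> // i; last by rewrite hs.
by apply/eqP; rewrite eqn_leq hs RAut_msizeX.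
Qed.

Lemma affine_id : affine id.
Proof. by split=> [|i]; [exact: RAut_id|rewrite msizeXi]. Qed.

Lemma affine_msize phi q : affine phi -> (msize q <= 2)%N -> (msize (phi q) <= 2)%N.
Proof.
move=> [h hs] /msize2_form[a [b [c ->]]]; case: (h) => hD _ _ hZ _.
rewrite !hD !hZ RAutC //.
apply: msizeD_bound; last exact: leq_trans (msizeC_le1 _) _.
by apply: msizeD_bound; apply: leq_trans (msizeZ_le _ _) (hs _).
Qed.

Lemma affine_comp phi psi : affine phi -> affine psi -> affine (phi \o psi).
Proof.
move=> h1 h2; split; first by apply: RAut_comp; [case: h1|case: h2].
by move=> i /=; apply: affine_msize => //; case: h2.
Qed.

Lemma mderivX_form (q : P) : q^Y = 0 -> (msize q <= 2)%N -> exists u c, q = u *: X + c%:MP.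
Proof.
move=> qY /msize2_form[a [b [c hq]]]; exists a, c; move: qY; rewrite hq.
rewrite !mderivD !mderivZ !mderivU mderivC eqxx /= scaler0 add0r addr0 alg_mpolyC => /eqP.
by rewrite mpolyC_eq0 => /eqP ->; rewrite scale0r addr0.
Qed.

Lemma triangular_fst phi q : triangular phi ->
  q^Y = 0 -> (msize q <= 2)%N -> (phi q)^Y = 0 /\ (msize (phi q) <= 2)%N.
Proof.
move=> [h hX hs hY] qY /(mderivX_form qY)[u [c ->]]; case: (h) => hD _ _ hZ _.
rewrite hD hZ RAutC // mderivD mderivZ hX mderivC scaler0 addr0; split=> //.
apply: msizeD_bound; last exact: leq_trans (msizeC_le1 _) _.
exact: leq_trans (msizeZ_le _ _) hs.
Qed.

Lemma triangular_snd phi q : triangular phi ->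
  (msize q^Y <= 1)%N -> (msize (phi q)^Y <= 1)%N.
Proof.
move=> [h hX hs hY] /(mderivYC_form hQ)[b [p ->]]; case: (h) => hD _ _ hZ _.
rewrite hD hZ RAut_at_poly // mderivD mderivZ at_poly_deriv // addr0.
exact: leq_trans (msizeZ_le _ _) hY.
Qed.

Lemma triangular_comp phi psi : triangular phi -> triangular psi -> triangular (phi \o psi).
Proof.
move=> h1 h2; case: (h1) (h2) => r1 _ _ _ [r2 f1 f2 s]; split.
- exact: RAut_comp.
- by case: (triangular_fst h1 f1 f2).
- by case: (triangular_fst h1 f1 f2).
- exact: (triangular_snd h1 s).
Qed.

Lemma combXY_const (a b c : R) : a *: X + b *: Y = c%:MP -> a = 0 /\ b = 0.
Proof.
move=> h; have hX := congr1 (fun p : P => p^X) h; have hY := congr1 (fun p : P => p^Y) h.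
move: hX hY; rewrite /= !mderivD !mderivZ !mderivU !mderivC eqxx /= !scaler0 addr0 add0r !alg_mpolyC.
by move=> /eqP; rewrite mpolyC_eq0 => /eqP -> /eqP; rewrite mpolyC_eq0 => /eqP ->.
Qed.

(* Cramer's rule: eliminating one variable from [a X, a Y] bounds the degrees of [b X, b Y]
   as soon as the determinant is nonzero, and a zero determinant contradicts injectivity. *)
Lemma affine_inv a b : affine a -> cancel a b -> cancel b a -> affine b.
Proof.
move=> [ha hs] ab ba; have hb := RAut_inv ha ab ba; split=> //.
have [bD _ _ bZ _] := hb.
have [al [be [c1 hX]]] := msize2_form (hs ord0).
have [ga [de [c2 hY]]] := msize2_form (hs ord_max).
have bX : X = al *: b X + be *: b Y + c1%:MP by rewrite -[LHS]ab hX !bD !bZ RAutC.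
have bY : Y = ga *: b X + de *: b Y + c2%:MP by rewrite -[LHS]ab hY !bD !bZ RAutC.
pose Delta := al * de - be * ga.
have eX : de *: X + (- be) *: Y = Delta *: b X + (de * c1 - be * c2)%:MP.
  rewrite {1}bY {1}bX -!mul_mpolyC /Delta !(mpolyCB, mpolyCM, mpolyCN); ring.
have eY : (- ga) *: X + al *: Y = Delta *: b Y + (al * c2 - ga * c1)%:MP.
  rewrite {1}bY {1}bX -!mul_mpolyC /Delta !(mpolyCB, mpolyCM, mpolyCN); ring.
have D0 : Delta != 0.
  apply/eqP => D0; move: eX eY; rewrite D0 !scale0r !add0r.
  move=> /combXY_const[_ /eqP]; rewrite oppr_eq0 => /eqP be0 /combXY_const[_ al0].
  have := RAut_msizeX ord0 ha; rewrite hX al0 be0 !scale0r !add0r.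
  by rewrite ltnNge msizeC_le1.
have bound u v w (q : P) : u *: X + v *: Y = Delta *: q + w%:MP -> (msize q <= 2)%N.
  move=> e; rewrite -(msizeZ q D0) (_ : Delta *: q = u *: X + v *: Y + (- w)%:MP).
    apply: msizeD_bound; last exact: leq_trans (msizeC_le1 _) _.
    by apply: msizeD_bound; apply: leq_trans (msizeZ_le _ _) _; rewrite msizeXi.
  by rewrite e mpolyCN addrK.
by move=> i; case: (ord2P i) => ->; [exact: bound eX|exact: bound eY].
Qed.

(** The chain rule applied to [e' (e Y) = Y], where [e'] fixes [x] too, writes 1 as a product with
    factor [e' (e Y)^Y]. In a domain this factor has degree 0, so the [y]-derivative of [e Y] is
    constant. *)
Lemma fixX_triangular e : is_RAut e -> e X = X -> triangular e.
Proof.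
move=> he eX; have [e' [ee' e'e]] := RAut_has_inv he.
have he' := RAut_inv he ee' e'e.
split=> //; rewrite ?eX ?mderivU ?msizeXi //.
have := mderiv_chain ord_max he' (e Y).
have -> : e' X = X by rewrite -[in LHS]eX ee'.
rewrite ee' !mderivU eqxx /= mulr0 add0r => h.
have n0 : e' (e Y)^Y * (e' Y)^Y != 0 by rewrite -h oner_eq0.
have [c hc] : exists c, e' (e Y)^Y = c%:MP.
  apply: msize_le1; apply: leq_trans (@msizeM_factor _ (e' Y)^Y _ _) _.
    by move: n0; rewrite mulf_eq0 negb_or => /andP[].
  by rewrite mulrC -h msize1.
by rewrite -(e'e (e Y)^Y) hc RAutC // msizeC_le1.
Qed.

(** * Substitutions, the exchange of variables, and tameness of triangular maps *)

Definition subst (F G : P) (p : P) : P := p \mPo [tuple F; G].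

Lemma substX F G : subst F G X = F. Proof. by rewrite /subst comp_mpolyXU. Qed.
Lemma substY F G : subst F G Y = G. Proof. by rewrite /subst comp_mpolyXU. Qed.

Lemma subst_RAut F G F' G' :
    subst F G F' = X -> subst F G G' = Y -> subst F' G' F = X -> subst F' G' G = Y ->
  is_RAut (subst F G).
Proof.
have hD A B p q : subst A B (p + q) = subst A B p + subst A B q by exact: comp_mpolyD.
have hM A B p q : subst A B (p * q) = subst A B p * subst A B q by exact: rmorphM.
have hC A B c : subst A B c%:MP = c%:MP by exact: comp_mpolyC.
move=> hX hY hX' hY'; split=> //; [exact: comp_mpoly1|move=> c p; exact: comp_mpolyZ|].
exists (subst F' G'); apply: mpoly_alg_ind => *; rewrite ?hC ?hD ?hM ?substX ?substY //; congruence.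
Qed.

Definition swap : P -> P := subst Y X.

Lemma swap_affine : affine swap.
Proof.
split; first by apply: (@subst_RAut _ _ Y X); rewrite ?substX ?substY.
by move=> i; case: (ord2P i) => ->; rewrite /swap ?substX ?substY msizeXi.
Qed.

Lemma swapK : involutive swap.
Proof.
have [h _] := swap_affine.
by apply: (RAut_eq (RAut_comp h h) RAut_id); rewrite /= /swap ?substX ?substY ?substX.
Qed.

(** With [phi X = u x + c] and [s] the map sending [x] to [u x + c] and fixing [y], one has
    [phi = (phi \o s') \o s] for the inverse [s'] of [s]. The left factor fixes [x], so both are
    elementary. *)
Lemma triangular_tame phi : triangular phi -> tame phi.
Proof.
case=> h hX hs _; have [u [c e]] := mderivX_form hX hs.
have [psi [h1 h2]] := RAut_has_inv h; have [pD _ _ pZ _] := RAut_inv h h1 h2.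
(* Comparing coefficients of [x] in [psi (phi X) = X] exhibits the inverse of [u]. *)
have uU : u \is a GRing.unit.
  have := congr1 (mcoeff U_(ord0)) (congr1 psi e).
  rewrite h1 pD pZ (RAutC _ (RAut_inv h h1 h2)) mcoeffD mcoeffZ mcoeffC mcoeffX eqxx.
  rewrite mnm1_eq0 mulr0 addr0 => h3.
  by apply/unitrPr; exists (psi X)@_U_(ord0).
have sX F G : subst F G (u *: X + c%:MP) = u *: F + c%:MP.
  by rewrite /subst comp_mpolyD comp_mpolyZ comp_mpolyC comp_mpolyXU.
pose s := subst (u *: X + c%:MP) Y.
pose s' := subst (u^-1 *: (X - c%:MP)) Y.
have hs1 F G : subst F G (u^-1 *: (X - c%:MP)) = u^-1 *: (F - c%:MP).
  by rewrite /subst comp_mpolyZ comp_mpolyB comp_mpolyC comp_mpolyXU.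
have k1 : u *: (u^-1 *: (X - c%:MP)) + c%:MP = X.
  by rewrite scalerA divrr // scale1r subrK.
have k2 : u^-1 *: (u *: X + c%:MP - c%:MP) = X.
  by rewrite addrK scalerA mulVr // scale1r.
have sR : is_RAut s.
  by apply: (@subst_RAut _ _ (u^-1 *: (X - c%:MP)) Y); rewrite ?hs1 ?sX ?substY.
have sR' : is_RAut s'.
  by apply: (@subst_RAut _ _ (u *: X + c%:MP) Y); rewrite ?hs1 ?sX ?substY.
have ss' : s \o s' =1 id.
  by apply: (RAut_eq (RAut_comp sR sR') RAut_id); rewrite /= /s /s' ?substX ?substY ?hs1 ?k2.
have s's : s' \o s =1 id.
  by apply: (RAut_eq (RAut_comp sR' sR) RAut_id); rewrite /= /s /s' ?substX ?substY ?sX ?k1.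
apply: (@tame_ext _ _ ((phi \o s') \o s)); last by move=> p; have /= -> := s's p.
apply: tame_comp; apply: tame_elementary; split.
- exact: RAut_comp.
- exists ord_max => j; case: (ord2P j) => -> //= _; rewrite /s' substX.
  have [hD _ _ hZ _] := h; rewrite hZ -[- _]mpolyCN hD RAutC // e.
  by rewrite mpolyCN k2.
- exact: sR.
- by exists ord0 => j; case: (ord2P j) => -> //= _; rewrite /s substY.
Qed.

Lemma tame_RAut phi : tame phi -> is_RAut phi.
Proof.
elim=> [f []//|f []//|f g _ hf _ hg|f g _ hf fg gf|f g _ hf fg]; first exact: RAut_comp.
- exact: RAut_inv hf fg gf.
- exact: RAut_ext hf fg.
Qed.

End Automorphisms.

(** * Words in the tame group *)

Section Words.
Variable R : idomainType.
Hypothesis hQ : Qdomain R.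
Local Notation P := {mpoly R[2]}.
Local Notation X := ('X_ord0 : P).
Local Notation Y := ('X_ord_max : P).
Local Notation "p ^Y" := (mderiv ord_max p) (at level 2, format "p ^Y").
Implicit Types (phi psi a b t e : P -> P) (w : seq (P -> P)).

(** Classical truth values turn affine and triangular shape into boolean predicates, so that [all],
    [path] and [cycle] apply to words. *)
Definition decideb (Q : Prop) : bool :=
  if excluded_middle_informative Q then true else false.

Lemma decideP Q : reflect Q (decideb Q).
Proof. by rewrite /decideb; case: excluded_middle_informative => h; constructor. Qed.

Definition isA phi := decideb (affine phi).
Definition isT phi := decideb (triangular phi).
Definition letter phi := isA phi || isT phi.
Definition mergeable phi psi := (isA phi && isA psi) || (isT phi && isT psi).
Definition strict phi := isT phi == ~~ isA phi.
Definition compose w : P -> P := foldr (fun f g => f \o g) id w.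

Lemma compose_cat w1 w2 : compose (w1 ++ w2) =1 compose w1 \o compose w2.
Proof. by elim: w1 => //= f w IH p /=; rewrite IH. Qed.

Lemma letter_tame phi : letter phi -> tame phi.
Proof.
case/orP=> /decideP h; last exact: triangular_tame.
by apply/tame_affine/affine_affine_aut.
Qed.

Lemma compose_tame w : all letter w -> tame (compose w).
Proof.
elim: w => [_|f w IH /= /andP[/letter_tame hf /IH hw]]; last exact: tame_comp.
exact/tame_affine/affine_affine_aut/affine_id.
Qed.

Lemma mergeable_letter phi psi : mergeable phi psi -> letter (phi \o psi).
Proof.
case/orP=> /andP[/decideP h1 /decideP h2]; apply/orP; [left|right]; apply/decideP.
  exact: affine_comp.
exact: triangular_comp.
Qed.

Lemma affine_letter_inv f g : affine f -> cancel f g -> cancel g f -> letter g.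
Proof. by move=> h1 h2 h3; apply/orP; left; apply/decideP; exact: affine_inv h1 h2 h3. Qed.

(** A map fixing [x] is a triangular letter by itself; one fixing [y] becomes such a letter after
    conjugation by the affine map [swap]. *)
Lemma elementary_word e : is_elementary_aut e -> exists w, all letter w /\ e =1 compose w.
Proof.
case=> he [i hi]; have sw := swap_affine R; have [swR _] := sw.
have lsw : letter (@swap R) by apply/orP; left; apply/decideP.
case: (ord2P i) hi => -> hi.
  exists [:: @swap R; @swap R \o e \o @swap R; @swap R]; split.
    rewrite /= lsw /= andbT; apply/orP; right; apply/decideP.
    apply: fixX_triangular => /=; first exact: RAut_comp (RAut_comp swR he) swR.
    by rewrite {2}/swap substX hi // /swap substY.
  by move=> p /=; rewrite !swapK.
exists [:: e]; split=> //=; rewrite andbT; apply/orP; right; apply/decideP.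
by apply: fixX_triangular => //; apply: hi.
Qed.

Lemma tame_word phi : tame phi ->
  exists w, all letter w /\ phi =1 compose w.
Proof.
(* A word for the inverse is carried along, so that the inversion case merely exchanges the two
   words. *)
suff H : tame phi -> exists w w', [/\ all letter w, all letter w', phi =1 compose w &
    cancel phi (compose w') /\ cancel (compose w') phi].
  by case/H => w [w' [h1 _ h2 _]]; exists w.
elim=> {phi} [f hf|f hf|f g tf [wf [wf' [h1 h2 h3 [h4 h5]]]] tg [wg [wg' [k1 k2 k3 [k4 k5]]]]
  |f g tf [w [w' [h1 h2 h3 [h4 h5]]]] fg gf|f g tf [w [w' [h1 h2 h3 [h4 h5]]]] fg].
- have af : affine f by apply/affine_affine_aut.
  have [g [fg gf]] := RAut_has_inv (proj1 af).
  exists [:: f], [:: g]; split=> //=; rewrite andbT.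
    by apply/orP; left; apply/decideP.
  exact: affine_letter_inv fg gf.
- have [g [fg gf]] := RAut_has_inv (proj1 hf).
  have hg : is_elementary_aut g.
    case: hf => hR [i hi]; split; first exact: RAut_inv fg gf.
    by exists i => j ji; rewrite -[in LHS](hi j ji) fg.
  have [w [h1 h2]] := elementary_word hf; have [w' [h1' h2']] := elementary_word hg.
  by exists w, w'; split=> //; split=> p; rewrite -h2' ?fg ?gf.
- exists (wf ++ wg), (wg' ++ wf'); rewrite !all_cat h1 h2 k1 k2; split=> //.
    by move=> p; rewrite compose_cat /= -k3 -h3.
  by split=> p; rewrite compose_cat /= ?h4 ?k4 ?k5 ?h5.
- exists w', w; split=> //; last by split=> p; rewrite -h3 ?fg ?gf.
  by move=> p; rewrite -[in LHS](h5 p) fg.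
- exists w, w'; split=> //; first by move=> p; rewrite -fg.
  by split=> p; rewrite -fg ?h4 ?h5.
Qed.

(** * Conjugacy in the tame group and cyclic reduction of words *)

Definition conjugate phi psi := exists a b,
  [/\ tame a, tame b, cancel a b, cancel b a & phi =1 a \o psi \o b].

Lemma conjugate_refl phi : conjugate phi phi.
Proof.
have h : tame (@id P) by exact/tame_affine/affine_affine_aut/affine_id.
by exists id, id.
Qed.

Lemma conjugate_trans f g h : conjugate f g -> conjugate g h -> conjugate f h.
Proof.
move=> [a [b [h1 h2 h3 h4 h5]]] [c [d [k1 k2 k3 k4 k5]]].
exists (a \o c), (d \o b); split; try exact: tame_comp; try exact: can_comp.
by move=> p; rewrite h5 /= k5.
Qed.

Lemma conjugate_ext f g h : conjugate f g -> g =1 h -> conjugate f h.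
Proof.
by move=> [a [b [h1 h2 h3 h4 h5]]] gh; exists a, b; split=> // p; rewrite h5 /= gh.
Qed.

(** The conjugating element is [compose w1]; hence rotating a word does not change its conjugacy
    class. *)
Lemma conjugate_catC w1 w2 : all letter w1 -> conjugate (compose (w1 ++ w2)) (compose (w2 ++ w1)).
Proof.
move=> /compose_tame h1; have [b [h2 h3]] := RAut_has_inv (tame_RAut h1).
exists (compose w1), b; split=> //; first exact: tame_inv h1 h2 h3.
by move=> p; rewrite /= !compose_cat /= h3.
Qed.

Lemma all_rot (T : Type) (q : pred T) i s : all q (rot i s) = all q s.
Proof. by rewrite /rot all_cat andbC -all_cat cat_take_drop. Qed.

Lemma conjugate_rot i w : all letter w -> conjugate (compose w) (compose (rot i w)).
Proof.
move=> lw; rewrite -{1}(cat_take_drop i w); apply: conjugate_catC.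
by move: lw; rewrite -{1}(cat_take_drop i w) all_cat => /andP[].
Qed.

Lemma not_path (T : Type) (r : rel T) x s : ~~ path r x s ->
  exists s1 y z s2, x :: s = s1 ++ y :: z :: s2 /\ ~~ r y z.
Proof.
elim: s x => //= y s IH x; rewrite negb_and => /orP[h|/IH[s1 [z [t [s2 [-> h]]]]]].
  by exists [::], x, y, s.
by exists (x :: s1), z, t, s2.
Qed.

(** A rotation brings the offending pair of cyclic neighbours to the front, where it can be
    merged. *)
Lemma not_cycle (T : Type) (r : rel T) x y s : ~~ cycle r [:: x, y & s] ->
  exists i u v s', rot i [:: x, y & s] = [:: u, v & s'] /\ ~~ r u v.
Proof.
move=> h0; have [s1 [z [t [s2 [e h]]]]] := not_path (h0 : ~~ path r x (rcons (y :: s) x)).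
(* Either the bad pair wraps around from the last letter to the first, or it lies inside the
   word. *)
case/lastP: s2 e => [|s2 v].
  rewrite -[[:: z; t]]/(rcons [:: z] t) -rcons_cat -rcons_cons => /rcons_inj[e1 e2].
  case: s1 e1 => [//|x' s1] [_ e1].
  exists (size (x :: s1)), z, t, s1; split=> //.
  by rewrite e1 -cat_cons rot_size_cat /= e2.
rewrite -!rcons_cons -rcons_cat => /rcons_inj[e _].
exists (size s1), z, t, (s2 ++ s1); split=> //.
by rewrite e rot_size_cat.
Qed.

(** Words start with a triangular and end with an affine letter, so concatenations, and in
    particular powers, alternate again. *)
Fixpoint alternating w : Prop :=
  match w with
  | [::] => True
  | t :: a :: w' =>
      [/\ triangular t, ~ affine t, affine a, ~ triangular a & alternating w']
  | _ => False
  end.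

(** A letter both affine and triangular would merge with any neighbour, whichever kind that
    neighbour has. *)
Lemma strict_letter f g : letter f -> letter g -> ~~ mergeable f g -> strict f.
Proof.
rewrite /letter /strict /mergeable.
by case: (isA f); case: (isT f); case: (isA g); case: (isT g).
Qed.

Lemma strict_path f w g : all letter (f :: w) -> letter g ->
  path (fun g h => ~~ mergeable g h) f (rcons w g) -> all strict (f :: w).
Proof.
elim: w f => [|h w IH] f /= /andP[lf lw] lg /andP[fh hw].
  by rewrite (strict_letter lf lg fh).
have lh : letter h by case/andP: lw.
by rewrite (strict_letter lf lh fh); apply: (IH h lw lg hw).
Qed.

Lemma all_last (T : Type) (q : pred T) x s : all q (x :: s) -> q (last x s).
Proof. by elim: s x => [|y s IH] x /= /andP[] // _ /IH. Qed.

Lemma alternating_path f w :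
    all strict (f :: w) -> path (fun g h => ~~ mergeable g h) f w ->
    isT f -> isA (last f w) -> alternating (f :: w).
Proof.
(* Letters are consumed in pairs, hence the induction on a bound for the length. *)
elim: {w}(size w) {-2}w (leqnn (size w)) f => [|n IH] w hw f.
  by case: w hw => //= _; rewrite andbT /strict => /eqP -> _ /negbTE ->.
case: w hw => [_|a w hw]; first by rewrite /= andbT /strict => /eqP -> _ /negbTE ->.
rewrite [all _ _]/= [path _ _ _]/= => /and3P[sf sa hall] /andP[fa hp] Tf hl.
have nAf : ~~ isA f by rewrite -(eqP sf).
have nTa : ~~ isT a by move: fa; rewrite /mergeable Tf negb_or => /andP[].
have Aa : isA a by move: nTa; rewrite (eqP sa) negbK.
split; [exact/decideP|by move/decideP; apply/negP|exact/decideP|by move/decideP; apply/negP|].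
case: w hw hall hp hl => [//|b w] hw hall hp hl.
have Tb : isT b.
  move: hp hall => /= /andP[+ _] /andP[+ _]; rewrite /mergeable Aa negb_or /= /strict.
  by move=> /andP[nA _] /eqP ->.
by apply: IH => //; [exact: ltnW|case/andP: hp].
Qed.

(** Induction on the length of a word for [phi]: while two cyclic neighbours merge, rotating and
    merging gives a shorter word with conjugate composite. *)
Lemma tame_normal_form phi : tame phi -> exists psi, conjugate phi psi /\
  [\/ affine psi, triangular psi |
      exists w, [/\ alternating w, w <> [::] & psi = compose w]].
Proof.
move=> /tame_word[w [lw ew]].
suff H : exists psi, conjugate (compose w) psi /\ [\/ affine psi, triangular psi |
      exists w, [/\ alternating w, w <> [::] & psi = compose w]].
  case: H => psi [[a [b [h1 h2 h3 h4 h5]]] h]; exists psi; split=> //.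
  by exists a, b; split=> // p; rewrite ew h5.
move=> {phi ew}; elim: {w}(size w) {-2}w (leqnn (size w)) lw => [|n IH] w.
  by case: w => // _ _; exists id; split; [exact: conjugate_refl|apply/Or31/affine_id].
case: w => [|f [|g w]] hw lw; first exact: (IH [::]).
  exists (compose [:: f]); split; first exact: conjugate_refl.
  by move: lw; rewrite /= andbT => /orP[] /decideP h; [apply: Or31|apply: Or32].
have [cyc|nc] := boolP (cycle (fun g h => ~~ mergeable g h) [:: f, g & w]); last first.
  have [i [z [t [s [e ht]]]]] := not_cycle nc.
  have lr : all letter [:: z, t & s] by rewrite -e all_rot.
  have [||psi [c h]] := IH (z \o t :: s).
  - by move: (congr1 size e); rewrite size_rot /= => -[] <-.
  - move: lr; rewrite /= => /and3P[_ _ ->]; rewrite andbT; apply: mergeable_letter.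
    by rewrite -[mergeable _ _]negbK.
  exists psi; split=> //; apply: conjugate_trans c.
  by apply: conjugate_ext (conjugate_rot i lw) _; rewrite e.
(* A cyclically reduced word alternates once its first letter is triangular; if [f] is not, rotation
   by one puts [g] first. *)
suff H f' w' : all letter (f' :: w') -> cycle (fun g h => ~~ mergeable g h) (f' :: w') ->
    isT f' -> alternating (f' :: w').
  case: (boolP (isT f)) => Tf.
    exists (compose [:: f, g & w]); split; first exact: conjugate_refl.
    by apply: Or33; exists [:: f, g & w]; split=> //; apply: H.
  have lr : all letter (rot 1 [:: f, g & w]) by rewrite all_rot.
  have cr : cycle (fun g h => ~~ mergeable g h) (rot 1 [:: f, g & w]) by rewrite rot_cycle.
  exists (compose (rot 1 [:: f, g & w])); split; first exact: conjugate_rot.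
  apply: Or33; exists (rot 1 [:: f, g & w]); split=> //; apply: H => //.
  (* Here [f] is affine and does not merge with [g], so [g] is not affine and must be triangular. *)
  move: lw cyc; rewrite /= /letter /mergeable (negbTE Tf) orbF => /and3P[-> + _] /andP[+ _].
  by rewrite andFb orbF; case: (isA g).
move=> lw' /= cyc' Tf'; have := cyc'; rewrite rcons_path => /andP[pw hl].
have lf' : letter f' by case/andP: lw'.
have sw := strict_path lw' lf' cyc'.
apply: alternating_path => //.
(* The last letter is cyclically followed by the triangular [f'], so it is not triangular, and being
   strict it is affine. *)
have := all_last sw.
move: hl; rewrite /mergeable /strict Tf' andbT negb_or => /andP[_ /negbTE ->].
by rewrite eq_sym; case: (isA (last _ _)).
Qed.

End Words.

(** * Degree growth and the theorem *)

Section Growth.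
Variable R : idomainType.
Hypothesis hQ : Qdomain R.
Local Notation P := {mpoly R[2]}.
Local Notation X := ('X_ord0 : P).
Local Notation Y := ('X_ord_max : P).
Local Notation "p ^Y" := (mderiv ord_max p) (at level 2, format "p ^Y").
Implicit Types (phi psi a b t e : P -> P) (w : seq (P -> P)).

(** The degree invariant that holds after each full triangular-affine pair of letters. *)
Definition dominant phi := (msize (phi Y) <= msize (phi X))%N.

(** Write [t Y = b y + h(x)]. As [t] is not affine, [h] has degree at least 2, so [h (phi X)]
    outweighs both [phi X] and [b phi Y]. The first inequality feeds [affine_growth], the second
    records the growth. *)
Lemma triangular_growth phi t : is_RAut phi -> triangular t -> ~ affine t -> dominant phi ->
  (msize (phi (t X)) < msize (phi (t Y)))%N /\ (msize (phi X) < msize (phi (t Y)))%N.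
Proof.
move=> hphi [ht tX sX tY] nt dom; have [pD _ _ pZ _] := hphi.
have [u [c eX]] := mderivX_form tX sX.
have [b [h eY]] := mderivYC_form hQ tY.
have F1 := RAut_msizeX ord0 hphi.
have h3 : (2 < size h)%N.
  rewrite ltnNge; apply/negP => h2; case: nt; split=> // i.
  case: (ord2P i) => -> //; rewrite eY; apply: msizeD_bound.
    by apply: leq_trans (msizeZ_le _ _) _; rewrite msizeXi.
  have [->|h0] := eqVneq h 0; first by rewrite at_poly0 msize0.
  rewrite msize_at_poly ?msizeXi // muln1.
  by move: h2 h0; rewrite -size_poly_eq0; case: (size h).
have h0 : h != 0 by rewrite -size_poly_eq0; case: (size h) h3.
have hh : (msize (phi X) < msize (at_poly (phi X) h))%N.
  rewrite msize_at_poly //; move: h3 F1.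
  case: (size h) => [|[|[|k]]] // _; case: (msize (phi X)) => [|[|m]] // _ /=; lia.
have eqY : msize (phi (t Y)) = msize (at_poly (phi X) h).
  rewrite eY pD pZ RAut_at_poly // addrC msizeDl //.
  exact: leq_ltn_trans (leq_trans (msizeZ_le _ _) dom) hh.
rewrite eqY; split=> //; apply: leq_ltn_trans hh.
rewrite eX pD pZ RAutC //; apply: msizeD_bound; first exact: msizeZ_le.
exact: leq_trans (msizeC_le1 _) (ltnW F1).
Qed.

(** As [a] is not triangular, [y] occurs in [a X] with a nonzero coefficient, so [phi (a X)]
    inherits the larger degree, that of [phi Y]; [phi (a Y)] cannot exceed it. *)
Lemma affine_growth phi a : is_RAut phi -> affine a -> ~ triangular a ->
  (msize (phi X) < msize (phi Y))%N ->
  dominant (phi \o a) /\ msize (phi (a X)) = msize (phi Y).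
Proof.
move=> hphi [ha hs] nt lt; have [pD _ _ pZ _] := hphi.
have [al [be [c eX]]] := msize2_form (hs ord0).
have F1 := RAut_msizeX ord0 hphi.
have b0 : be != 0.
  apply/eqP => b0; case: nt; split => //; last first.
    by apply: leq_trans (msize_mderiv _ _) _; move: (hs ord_max); case: (msize _).
  by rewrite eX b0 scale0r addr0 mderivD mderivZ mderivU mderivC /= scaler0 addr0.
have e : msize (phi (a X)) = msize (phi Y).
  rewrite eX !pD !pZ RAutC // [al *: _ + _]addrC -addrA msizeDl ?msizeZ //.
  apply: leq_ltn_trans lt; apply: msizeD_bound; first exact: msizeZ_le.
  exact: leq_trans (msizeC_le1 _) (ltnW F1).
split=> //; rewrite /dominant /= e.
have [al' [be' [c' ->]]] := msize2_form (hs ord_max).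
rewrite !pD !pZ RAutC //.
apply: msizeD_bound; last exact: leq_trans (msizeC_le1 _) (leq_trans (ltnW F1) (ltnW lt)).
by apply: msizeD_bound; rewrite (leq_trans (msizeZ_le _ _)) // ltnW.
Qed.

(** The prefix [phi] is arbitrary so that the induction can absorb the leading pair [t], [a] into
    it. *)
Lemma alternating_growth w phi : alternating w -> is_RAut phi -> dominant phi ->
  [/\ is_RAut (phi \o compose w), dominant (phi \o compose w) &
      w <> [::] -> (msize (phi X) < msize (phi (compose w X)))%N].
Proof.
elim: {w}(size w) {-2}w (leqnn (size w)) phi => [|n IH] w hw phi.
  by case: w hw.
case: w hw => [_ _ //|t [//|a w]] hw [ht nt ha na hal] hphi dom.
have [g1 g2] := triangular_growth hphi ht nt dom.
have rt : is_RAut (phi \o t) by apply: RAut_comp; last by case: ht.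
have [d e] := affine_growth rt ha na g1.
have ra : is_RAut (phi \o t \o a) by apply: RAut_comp; last by case: ha.
have [k1 k2 k3] := IH w (ltnW hw) _ hal ra d.
split=> // _; rewrite /= in e k3 *.
apply: leq_trans g2 _; rewrite -e; case: w k3 {hw hal k1 k2} => // f w k3.
by apply: ltnW; apply: k3.
Qed.

(** Each power of the word is again [dominant] and serves as prefix for the next copy, which raises
    the degree of the image of [x] by at least one. *)
Lemma alternating_iter_unbounded w : alternating w -> w <> [::] ->
  forall m, (m < msize (iter m (compose w) X))%N.
Proof.
move=> hw w0 m.
suff [_ _] : [/\ is_RAut (iter m (compose w)), dominant (iter m (compose w)) &
    (m < msize (iter m (compose w) X))%N] by [].
elim: m => [|m [r d lt]].
  by split; [exact: RAut_id|rewrite /dominant /= !msizeXi|rewrite /= msizeXi].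
have [k1 k2 k3] := alternating_growth hw r d.
have e : iter m (compose w) \o compose w =1 iter m.+1 (compose w) by move=> p; rewrite iterSr.
split; first exact: RAut_ext k1 e.
  by rewrite /dominant -!e.
by rewrite -e /=; apply: leq_ltn_trans lt (k3 w0).
Qed.

End Growth.

(** * From the shape of [exp (f D)] to that of [exp D] *)

Section Conclusion.
Variable R : idomainType.
Hypothesis hQ : Qdomain R.
Local Notation P := {mpoly R[2]}.
Local Notation X := ('X_ord0 : P).
Local Notation Y := ('X_ord_max : P).
Local Notation "p ^X" := (mderiv ord0 p) (at level 2, format "p ^X").
Local Notation "p ^Y" := (mderiv ord_max p) (at level 2, format "p ^Y").
Implicit Types (phi psi a b : P -> P) (D E : P -> P).

Lemma iter_kermul D f : is_LND D -> D f = 0 ->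
  forall l p, iter l (fun p => f * D p) p = f ^+ l * iter l D p.
Proof.
move=> hD hf l p; have fl k : D (f ^+ k) = 0.
  elim: k => [|k IH]; first by rewrite expr0 -mpolyC1 (derC _ (proj1 hD)).
  by rewrite exprS derM // hf IH mul0r mulr0 addr0.
elim: l => [|l /= ->]; first by rewrite expr0 mul1r.
by rewrite (derM hD) fl mul0r add0r mulrA -exprS.
Qed.

Lemma LND_kermul D f : is_LND D -> D f = 0 -> is_LND (fun p => f * D p).
Proof.
move=> hD hf; have [[DD DZ DM] hn] := hD; split.
  split=> [p q|c p|p q]; first by rewrite DD mulrDr.
    by rewrite DZ -scalerAr.
  by rewrite DM; ring.
by move=> p; have [l hl] := hn p; exists l; rewrite iter_kermul // hl mulr0.
Qed.

Section Conjugation.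
Variables a b : P -> P.
Hypotheses (ha : is_RAut a) (ab : cancel a b) (ba : cancel b a).
Let conj D := b \o D \o a.

Lemma iter_conj D l p : iter l (conj D) p = b (iter l D (a p)).
Proof. by elim: l => [|l /= ->] /=; rewrite ?ab // /conj /= ba. Qed.

Lemma LND_conj D : is_LND D -> is_LND (conj D).
Proof.
have [aD aM _ aZ _] := ha; have hb := RAut_inv ha ab ba; have [bD bM _ bZ _] := hb.
move=> [[DD DZ DM] hn]; split.
  split=> [p q|c p|p q]; rewrite /conj /=; first by rewrite aD DD bD.
    by rewrite aZ DZ bZ.
  by rewrite aM DM bD !bM !ab.
by move=> p; have [l hl] := hn (a p); exists l; rewrite iter_conj hl RAut0.
Qed.

Lemma lnd_exp_conj D : is_LND D -> lnd_exp (conj D) =1 b \o lnd_exp D \o a.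
Proof.
move=> hD p; have hb := RAut_inv ha ab ba; have [bD _ _ bZ _] := hb.
have h := iterD_nilidx hD (a p).
have h' : iter (nilidx D (a p)) (conj D) p = 0 by rewrite iter_conj h RAut0.
rewrite /= (lnd_exp_sum (LND_conj hD) h') (lnd_exp_sum hD h).
rewrite (big_morph b bD (RAut0 hb)).
by apply: eq_bigr => i _; rewrite /dpow iter_conj bZ.
Qed.

End Conjugation.

Lemma lnd_exp_in (U : P -> Prop) D p : is_LND D ->
    (forall p q, U p -> U q -> U (p + q)) -> (forall c p, U p -> U (c *: p)) ->
    (forall p, U p -> U (D p)) -> U p -> U (lnd_exp D p).
Proof.
move=> hD UD UZ US Up; rewrite (lnd_exp_sum hD (iterD_nilidx hD p)).
have U0 : U 0 by rewrite -(scale0r p); apply: UZ.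
apply: (big_ind U) => // i _; apply: UZ.
by elim: (nat_of_ord i) => //= l; apply: US.
Qed.

(** The polynomials of degree at most 1 are stable under [exp (f D)], hence under [f D]. Removing
    the nonzero factor [f] cannot raise degrees, so [D], and then [exp D], preserves them too. *)
Lemma lnd_exp_affine D f : is_LND D -> D f = 0 -> f != 0 ->
  affine (lnd_exp (fun p => f * D p)) -> affine (lnd_exp D).
Proof.
move=> hD Df f0 hA; have hE := LND_kermul hD Df.
pose U (p : P) := (msize p <= 2)%N.
have UD p q : U p -> U q -> U (p + q) by exact: msizeD_bound.
have UZ c p : U p -> U (c *: p) by move=> h; apply: leq_trans (msizeZ_le _ _) h.
have UX i : U 'X_i by rewrite /U msizeXi.
have Ue p : U p -> U (lnd_exp (fun p => f * D p) p) by exact: affine_msize hA.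
have st i := lnd_exp_stable (U := U) hE UD UZ Ue (UX i) 1.
have UDX i : U (D 'X_i) by apply: leq_trans (msizeM_factor _ f0) (st i).
have UDp p : U p -> U (D p).
  move=> /msize2_form[al [be [c ->]]]; rewrite !(derD hD) !(derZ hD) (derC _ (proj1 hD)).
  by rewrite addr0; apply: UD; apply: UZ; apply: UDX.
by split; [exact: lnd_exp_RAut|move=> i; exact: lnd_exp_in UDp (UX i)].
Qed.

(** The same argument runs with two stable subspaces: [U1], spanned by 1 and [x], and [U2], the
    polynomials [b y + h(x)]. Dividing by [f] now also requires that [y] does not enter the
    quotients, which factorial closedness provides. *)
Lemma lnd_exp_triangular D f : is_LND D -> D f = 0 -> f != 0 ->
  triangular (lnd_exp (fun p => f * D p)) -> triangular (lnd_exp D).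
Proof.
move=> hD Df f0 hT; have hE := LND_kermul hD Df.
have hY := mderiv_LND R ord_max.
pose U1 (p : P) := p^Y = 0 /\ (msize p <= 2)%N.
pose U2 (p : P) := (msize p^Y <= 1)%N.
have U1D p q : U1 p -> U1 q -> U1 (p + q).
  by move=> [h1 h2] [h3 h4]; split; [rewrite mderivD h1 h3 addr0|exact: msizeD_bound].
have U1Z c p : U1 p -> U1 (c *: p).
  by move=> [h1 h2]; split; [rewrite mderivZ h1 scaler0|exact: leq_trans (msizeZ_le _ _) h2].
have U2D p q : U2 p -> U2 q -> U2 (p + q) by rewrite /U2 mderivD; exact: msizeD_bound.
have U2Z c p : U2 p -> U2 (c *: p).
  by rewrite /U2 mderivZ; apply: leq_trans (msizeZ_le _ _).
have U1e p : U1 p -> U1 (lnd_exp (fun p => f * D p) p) by case; exact: triangular_fst.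
have U2e p : U2 p -> U2 (lnd_exp (fun p => f * D p) p) by exact: triangular_snd.
have U1X : U1 X by rewrite /U1 mderivU msizeXi.
have U2Y : U2 Y by rewrite /U2 mderivU eqxx msize1.
have [fX sX] : U1 (f * D X) := lnd_exp_stable (U := U1) hE U1D U1Z U1e U1X 1.
have fY : U2 (f * D Y) := lnd_exp_stable (U := U2) hE U2D U2Z U2e U2Y 1.
have hder : is_Rderivation D by case: hD.
have DX1 : U1 (D X).
  have [->|DX0] := eqVneq (D X) 0; first by rewrite /U1 mderiv0 msize0.
  split; last exact: leq_trans (msizeM_factor _ f0) sX.
  by apply: (ker_factorially_closed hQ hY _ fX); rewrite mulf_neq0.
have DY1 : U2 (D Y).
  have [DY0|DY0] := eqVneq (D Y) 0; first by rewrite /U2 DY0 mderiv0 msize0.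
  (* If [D X = 0], the chain rule turns [D f = 0] into [f^Y * D Y = 0]; otherwise [f] divides the
     nonzero polynomial [f * D X], which is free of [y]. *)
  have fker : f^Y = 0.
    have [DX0|DX0] := eqVneq (D X) 0.
      move: Df; rewrite (derivation_chain hder) DX0 mulr0 add0r => /eqP.
      by rewrite mulf_eq0 (negbTE DY0) orbF => /eqP.
    by rewrite mulrC in fX; apply: (ker_factorially_closed hQ hY _ fX); rewrite mulf_neq0.
  move: fY; rewrite /U2 mderivM fker mul0r add0r.
  exact: leq_trans (msizeM_factor _ f0).
have const (p : P) i : (msize p <= 1)%N -> p^`M(i) = 0.
  by move=> /msize_le1[c ->]; rewrite mderivC.
have US1 p : U1 p -> U1 (D p).
  move=> [/mderivX_form pY /pY[u [c ->]]]; rewrite (derD hD) (derZ hD) (derC _ hder) addr0.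
  exact: U1Z.
(* Differentiating [D p = p^X * D X + p^Y * D Y] in [y] leaves only the constant [p^Y] times the
   [y]-derivative of [D Y]: the derivatives of [p^Y] vanish, and so does that of [D X]. *)
have US2 p : U2 p -> U2 (D p).
  move=> pY; rewrite /U2 (derivation_chain hder) mderivD !mderivM.
  rewrite mderiv_comm !(const p^Y) // (proj1 DX1) mulr0 !mul0r !add0r.
  have [c ->] := msize_le1 pY; rewrite mul_mpolyC.
  exact: leq_trans (msizeZ_le _ _) DY1.
have [k1 k2] := lnd_exp_in hD U1D U1Z US1 U1X.
by split=> //; [exact: lnd_exp_RAut|exact: lnd_exp_in U2D U2Z US2 U2Y].
Qed.

End Conclusion.

Theorem theorem3p1p2 (R : idomainType) (hQ : Qdomain R)
  (D : {mpoly R[2]} -> {mpoly R[2]}) (hD : is_LND D)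
  (f : {mpoly R[2]}) (hfker : D f = 0) (hf0 : f != 0)
  (hT : tame (lnd_exp (fun p => f * D p))) :
  tame (lnd_exp D).
Proof.
have [psi [[a [b [ta tb ab ba e]]] hpsi]] := tame_normal_form hQ hT.
have ra := tame_RAut ta; have rb := tame_RAut tb.
have hE := LND_kermul hD hfker.
pose D' := b \o D \o a.
have hD' : is_LND D' by exact: LND_conj.
have D'f : D' (b f) = 0 by rewrite /D' /= ba hfker RAut0.
have f'0 : b f != 0 by exact: RAut_neq0.
have hE' := LND_kermul hD' D'f.
have e' : psi =1 lnd_exp (fun p => b f * D' p).
  have -> : lnd_exp (fun p => b f * D' p) = lnd_exp (b \o (fun p => f * D p) \o a).
    (* Multiplicativity of [b] identifies multiplication of [D'] by [b f] with the conjugate of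
       [f D]. *)
    congr lnd_exp; apply: functional_extensionality => p.
    by case: rb => _ bM _ _ _; rewrite /= bM.
  by move=> p; rewrite (lnd_exp_conj ra ab ba hE) /= e /= !ab.
suff tD' : tame (lnd_exp D').
  apply: (@tame_ext _ _ (a \o lnd_exp D' \o b)); first exact: tame_comp (tame_comp ta tD') tb.
  by move=> p; rewrite /= (lnd_exp_conj ra ab ba hD) /= !ba.
case: hpsi => [[r hs]|[r h1 h2 h3]|[w [hw w0 ew]]].
- apply/tame_affine/affine_affine_aut/(lnd_exp_affine hQ hD' D'f f'0).
  by split; [exact: RAut_ext r e'|move=> i; rewrite -e'].
- apply/triangular_tame/(lnd_exp_triangular hQ hD' D'f f'0).
  by split; rewrite -?e' //; exact: RAut_ext r e'.
(* An alternating word is impossible: its powers would have unbounded degree on [x], whereas those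
   of an exponential stay bounded. *)
have [B hB] := iter_lnd_exp_bounded hE' 'X_ord0.
have := alternating_iter_unbounded hQ hw w0 B; rewrite -ew (eq_iter e').
by rewrite ltnNge hB.
Qed.
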